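(* There is a polynomial-time algorithm that, given a permutation $\pi$ of $\{1,\ldots,n\}$ and a map $c:\{1,\ldots,n\}\to\{1,2,3\}$, decides whether there exists a partition $\mathcal{P}$ of $\{1,\ldots,n\}$ into triples such that for every $\{i,j,k\}\in\mathcal{P}$ with $i<j<k$ one has $\pi(i)<\pi(j)<\pi(k)$ and $c(\pi(i))=1$, $c(\pi(j))=2$, $c(\pi(k))=3$. *)

(* Defs.v *)
From mathcomp Require Import all_boot all_fingroup.
Set Implicit Arguments. Unset Strict Implicit. Unset Printing Implicit Defensive.

(* The combinatorial problem.  Elements of {1..n} are represented by    *)
(* 'I_n (i.e. 0..n-1), colours {1,2,3} by 'I_3 (i.e. 0,1,2).            *)

Definition good_triple_partition (n : nat) (pi : {perm 'I_n})
    (c : 'I_n -> 'I_3) (P : {set {set 'I_n}}) : Prop :=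
  partition P [set: 'I_n] /\
  forall B, B \in P ->
    #|B| = 3 /\
    forall i j k : 'I_n, B = [set i; j; k] -> (i < j)%N -> (j < k)%N ->
      [/\ (pi i < pi j)%N, (pi j < pi k)%N,
          val (c (pi i)) = 0, val (c (pi j)) = 1 & val (c (pi k)) = 2].

Definition has_good_triple_partition n (pi : {perm 'I_n}) (c : 'I_n -> 'I_3) : Prop :=
  exists P, good_triple_partition pi c P.

(* Model of computation: a unit-cost RAM-style while language with      *)
(* natural-number variables, an unbounded nat-addressed memory, and      *)
(* only addition / truncated subtraction / comparisons (no multiplication), *)
(* which is polynomially equivalent to Turing machines.                 *)

Inductive aexp : Type :=
  | ANum (k : nat)
  | AVar (x : nat)
  | APlus (a b : aexp)
  | AMinus (a b : aexp)
  | ALoad (a : aexp)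
  | AEq (a b : aexp)
  | ALt (a b : aexp).

Record state : Type := State { vars : nat -> nat; mem : nat -> nat }.

Fixpoint aeval (s : state) (e : aexp) : nat :=
  match e with
  | ANum k => k
  | AVar x => vars s x
  | APlus a b => aeval s a + aeval s b
  | AMinus a b => aeval s a - aeval s b
  | ALoad a => mem s (aeval s a)
  | AEq a b => nat_of_bool (aeval s a == aeval s b)
  | ALt a b => nat_of_bool (aeval s a < aeval s b)
  end.

Inductive com : Type :=
  | CSkip
  | CAsgn (x : nat) (e : aexp)
  | CStore (addr e : aexp)
  | CSeq (c1 c2 : com)
  | CIf (b : aexp) (c1 c2 : com)
  | CWhile (b : aexp) (body : com).

Definition upd (f : nat -> nat) (x v : nat) : nat -> nat :=
  fun y => if y == x then v else f y.

Inductive exec : com -> state -> state -> nat -> Prop :=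
  | E_Skip s : exec CSkip s s 1
  | E_Asgn s x e :
      exec (CAsgn x e) s (State (upd (vars s) x (aeval s e)) (mem s)) 1
  | E_Store s a e :
      exec (CStore a e) s (State (vars s) (upd (mem s) (aeval s a) (aeval s e))) 1
  | E_Seq c1 c2 s s1 s2 t1 t2 :
      exec c1 s s1 t1 -> exec c2 s1 s2 t2 -> exec (CSeq c1 c2) s s2 (t1 + t2).+1
  | E_IfT b c1 c2 s s' t :
      aeval s b != 0 -> exec c1 s s' t -> exec (CIf b c1 c2) s s' t.+1
  | E_IfF b c1 c2 s s' t :
      aeval s b = 0 -> exec c2 s s' t -> exec (CIf b c1 c2) s s' t.+1
  | E_WhileF b c s :
      aeval s b = 0 -> exec (CWhile b c) s s 1
  | E_WhileT b c s s1 s2 t1 t2 :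
      aeval s b != 0 -> exec c s s1 t1 -> exec (CWhile b c) s1 s2 t2 ->
      exec (CWhile b c) s s2 (t1 + t2).+1.

(* Input encoding: all variables 0; mem 0 = n; mem (1+i) = pi i;
   mem (1+n+i) = c i (for i < n); all other cells 0. *)
Definition init_state n (pi : {perm 'I_n}) (c : 'I_n -> 'I_3) : state :=
  State (fun _ => 0)
        (fun a =>
           if a == 0 then n
           else if insub (a.-1) is Some i then val (pi i : 'I_n)
           else if insub (a.-1 - n) is Some i then val (c i : 'I_3)
           else 0).

Definition output (s : state) : bool := vars s 0 != 0.

(* Main.v *)
(** A chain [r < g < b] in the dominance order is the conjunction of [r < g] and
    [g < b], so the partition exists iff two independent bipartite dominance
    matchings do: colour 0 with colour 1, and colour 1 with colour 2.  Each is
    decided by a left-to-right sweep that keeps the set of unmatched lower values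
    and gives every upper point the largest unmatched value below its own; an
    exchange argument shows that this choice never hurts.  The sweep takes
    quadratic time. *)

Require Import Defs.
From mathcomp Require Import all_boot all_fingroup.
From mathcomp Require Import zify.
Set Implicit Arguments. Unset Strict Implicit. Unset Printing Implicit Defensive.

(** * Bipartite dominance matching by a greedy sweep *)

Section Greedy.
Variables (n : nat) (lo hi : pred 'I_n).
Implicit Types (A : {set 'I_n}) (l : seq 'I_n) (x y z : 'I_n).

(** Indexed by [nat] and not by ['I_n], so that it can describe memory cells at any offset; it is
    false from [n] on. *)
Definition flag A (v : nat) : bool := [exists y in A, val y == v].

Lemma flag_ord A y : flag A y = (y \in A).
Proof.
apply/existsP/idP => [[z /andP[zA /eqP/val_inj <-]] // | yA].
by exists y; rewrite yA /=.
Qed.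

Lemma flag_ge A v : n <= v -> flag A v = false.
Proof.
move=> nv; apply/existsP => -[z /andP[_ /eqP zv]].
by move: (ltn_ord z); rewrite zv ltnNge nv.
Qed.

Lemma flag_set0 v : flag set0 v = false.
Proof. by apply/existsP => -[z]; rewrite inE. Qed.

Lemma flag_setU1 A x v : flag (x |: A) v = (v == x) || flag A v.
Proof.
have [nv|vn] := leqP n v.
  rewrite !flag_ge // orbF; apply/esym/eqP => vx.
  by move: (ltn_ord x); rewrite -vx ltnNge nv.
by rewrite !(flag_ord _ (Ordinal vn)) !inE.
Qed.

Lemma flag_setD1 A x v : flag (A :\ x) v = (v != x) && flag A v.
Proof.
have [nv|vn] := leqP n v; first by rewrite !flag_ge // andbF.
by rewrite !(flag_ord _ (Ordinal vn)) !inE.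
Qed.

(* One plus the largest [v < p] satisfying [f], and 0 if there is none. *)
Fixpoint last_below (f : pred nat) (p : nat) : nat :=
  if p is p'.+1 then (if f p' then p else last_below f p') else 0.

Lemma last_below_eq0 f p v : last_below f p = 0 -> v < p -> f v = false.
Proof.
elim: p => // p IH /=; case: ifP => // fp /IH{}IH.
by rewrite ltnS leq_eqVlt => /orP[/eqP->|/IH].
Qed.

Lemma last_belowS f p w :
  last_below f p = w.+1 ->
  [/\ w < p, f w & forall v, v < p -> f v -> v <= w].
Proof.
elim: p => // p IH /=; case: ifP => [fp [<-]|fp /IH[wp fw H]].
  by split=> // v; rewrite ltnS.
split=> // [|v]; first exact: ltnW.
rewrite ltnS leq_eqVlt => /orP[/eqP->|/H //]; by rewrite fp.
Qed.

Definition best A x : nat := last_below (flag A) x.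

Lemma best_eq0 A x y : best A x = 0 -> y \in A -> y < x -> False.
Proof. by move=> /last_below_eq0 H yA /H; rewrite flag_ord yA. Qed.

Lemma best_neq0 A x : best A x != 0 ->
  exists y, [/\ best A x = y.+1, y \in A, y < x &
    forall z, z \in A -> z < x -> z <= y].
Proof.
rewrite /best; case E : last_below => [//|w] _.
have [wx fw H] := last_belowS E.
have wn := ltn_trans wx (ltn_ord x).
exists (Ordinal wn); split=> //; first by rewrite -flag_ord.
by move=> z zA zx; apply: H => //; rewrite flag_ord.
Qed.

(** The list carries values in the order of their positions and [A] holds the lower values seen and
    not yet matched. Emptiness of [A] at the end makes the matching perfect on the lower side. *)
Fixpoint greedy A l : bool :=
  if l is x :: l' then
    if lo x then greedy (x |: A) l'
    else if hi x then
      (best A x != 0) && greedy [set y in A | y.+1 != best A x] l'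
    else greedy A l'
  else A == set0.

(** The nondeterministic sweep, in which an upper point may take any available smaller value. It
    mediates between the greedy rule and matchings given as functions. *)
Fixpoint ndmatch A l : Prop :=
  if l is x :: l' then
    if lo x then ndmatch (x |: A) l'
    else if hi x then exists y, [/\ y \in A, y < x & ndmatch (A :\ y) l']
    else ndmatch A l'
  else A = set0.

Lemma setU1_D1 A x y : x != y -> (x |: A) :\ y = x |: A :\ y.
Proof. by move=> xy; apply/setP=> u; rewrite !inE; case: (eqVneq u x) => [->|//]; rewrite xy. Qed.

(* A smaller available value can replace a larger one in any continuation. *)
Lemma ndmatch_exchange A l x y :
  uniq l -> x \notin A -> y \notin A -> x \notin l -> y \notin l -> y < x ->
  ndmatch (x |: A) l -> ndmatch (y |: A) l.
Proof.
elim: l A => [|z l IH] A /=.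
  by move=> _ _ _ _ _ _ /setP/(_ x); rewrite !inE eqxx.
move=> /andP[zl ul] xA yA; rewrite !inE !negb_or => /andP[xz xl] /andP[yz yl] yx.
case: ifP => [_|_].
  rewrite !(setUCA [set z]); apply: IH; by rewrite // !inE negb_or ?xz ?yz.
case: ifP => [_ [w [wA wz H]]|_]; last exact: IH.
move: wA wz H; rewrite !inE; have [-> _ xz'|wx /= wA wz] := eqVneq w x.
  rewrite setU1K // => H; exists y; rewrite setU11 setU1K //.
  by split=> //; apply: ltn_trans yx xz'.
rewrite setU1_D1 1?eq_sym // => H; exists w.
have wy : w != y by apply: contraNneq yA => <-.
split=> //; first by rewrite !inE wA orbT.
by rewrite setU1_D1 1?eq_sym //; apply: IH H; rewrite // !inE negb_and ?xA ?yA orbT.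
Qed.

(** The greedy choice is one of the nondeterministic ones. Conversely, if a run takes [w] where the
    largest candidate is [y], then it continues with [y] available and [w] gone; the exchange lemma
    trades [y] for the smaller [w]. *)
Lemma greedyP A l :
  uniq l -> (forall y, y \in A -> y \notin l) -> greedy A l <-> ndmatch A l.
Proof.
elim: l A => [|x l IH] A /=; first by move=> _ _; split=> [/eqP|/eqP].
move=> /andP[xl ul] Al.
have Al' y : y \in A -> y \notin l by move=> /Al; rewrite inE negb_or => /andP[].
case: ifP => _; first by apply: IH => // y; rewrite !inE => /orP[/eqP->|/Al'].
case: ifP => _; last exact: IH.
split.
  case/andP=> /best_neq0[y [-> yA yx _]].
  have -> : [set z in A | z.+1 != y.+1] = A :\ y.
    by apply/setP=> z; rewrite !inE eqSS andbC.
  move=> /IH H; exists y; split=> //; apply: H => // z; rewrite inE => /andP[_ /Al'] //.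
case=> w [wA wx H].
have b0 : best A x != 0 by apply/eqP => /best_eq0 /(_ wA wx).
rewrite b0; have [y [-> yA yx ymax]] := best_neq0 b0.
have -> : [set z in A | z.+1 != y.+1] = A :\ y.
  by apply/setP=> z; rewrite !inE eqSS andbC.
apply/IH => // [z|]; first by rewrite inE => /andP[_ /Al'].
have [<- //|wy] := eqVneq w y.
have wlty : w < y by rewrite ltn_neqAle ymax // andbT; apply: contraNneq wy => /val_inj->.
have e : A :\ w :\ y = A :\ y :\ w by apply/setP=> u; rewrite !inE andbCA.
have yAw : y \in A :\ w by rewrite !inE eq_sym wy.
have wAy : w \in A :\ y by rewrite !inE wy.
rewrite -(setD1K wAy) -e; rewrite -(setD1K yAw) in H.
by apply: ndmatch_exchange H; rewrite ?Al' // !inE ?eqxx //= andbF.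
Qed.

(** Two orders are at work: [f x < x] compares values, while [index] compares positions. Values in
    [A] count as lying to the left of the whole list. *)
Definition dominance_matching A l (f : 'I_n -> 'I_n) : Prop :=
  [/\ {in [pred x | (x \in l) && hi x] &, injective f},
      forall x, x \in l -> hi x ->
        (f x < x) && ((f x \in A) || [&& f x \in l, lo (f x) & index (f x) l < index x l])
    & forall y, (y \in A) || ((y \in l) && lo y) ->
        exists x, [/\ x \in l, hi x & f x = y]].

(** Induction on the list: a lower head moves into [A], and an upper head removes its partner from
    [A]. *)
Lemma ndmatchP A l :
  (forall x, lo x -> hi x = false) ->
  uniq l -> (forall y, y \in A -> y \notin l) ->
  ndmatch A l <-> exists f, dominance_matching A l f.
Proof.
move=> lohi; elim: l A => [|x l IH] A /=.
  move=> _ _; split=> [->|[f [_ _ H]]].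
    by exists id; split=> // y; rewrite !inE.
  by apply/setP=> y; rewrite inE; apply/negP=> yA; have [|x []] := H y; rewrite ?yA.
move=> /andP[xl ul] Al.
have Al' y : y \in A -> y \notin l by move=> /Al; rewrite inE negb_or => /andP[].
have Ax y : y \in A -> y != x by move=> /Al; rewrite inE negb_or => /andP[].
have nx y : y \in l -> (x == y) = false by move=> yl; apply/eqP=> e; rewrite e yl in xl.
case: ifP => lox.
  (* Lower head: the same [f] serves both sides, because index 0 in the list and membership in the
     enlarged [A] both place [x] before every later point. *)
  rewrite IH // => [|y]; last by rewrite !inE => /orP[/eqP->|/Al'].
  split=> -[f [fi fx fs]]; exists f; split.
  - move=> y z; rewrite !inE => /andP[/orP[/eqP->|yl] hy]; first by rewrite lohi in hy.
    move=> /andP[/orP[/eqP->|zl] hz]; first by rewrite lohi in hz.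
    by apply: fi; rewrite inE ?yl ?zl.
  - move=> y; rewrite !inE => /orP[/eqP->|yl] hy; first by rewrite lohi in hy.
    have := fx y yl hy; rewrite !inE /= (nx y) // [x == _]eq_sym.
    by case: eqP => [->|_] //=; rewrite ?lox //= ?orbT.
  - move=> y; rewrite !inE => H.
    have [|z [zl hz e]] := fs y; last by exists z; rewrite !inE zl orbT.
    by rewrite !inE; case: eqP H => //= _ /orP[->|->]; rewrite ?orbT.
  - move=> y z; rewrite !inE => /andP[yl hy] /andP[zl hz].
    by apply: fi; rewrite !inE ?yl ?zl orbT.
  - move=> y yl hy; have := fx y; rewrite !inE yl orbT /= (nx y) // [x == _]eq_sym.
    by move=> /(_ isT hy); case: eqP => [->|_] //=; rewrite ?lox //= ?orbT.
  - move=> y; rewrite !inE => H.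
    have [|z [zl hz e]] := fs y.
      by rewrite !inE; case: eqP H => [->|_] /=; rewrite ?lox ?orbT.
    exists z; split=> //; move: zl; rewrite inE => /orP[/eqP zx|//].
    by rewrite zx lohi in hz.
case: ifP => hix; last first.
  rewrite IH //.
  split=> -[f [fi fx fs]]; exists f; split.
  - move=> y z; rewrite ?inE => /andP[/orP[/eqP->|yl] hy]; first by rewrite hix in hy.
    move=> /andP[/orP[/eqP->|zl] hz]; first by rewrite hix in hz.
    by apply: fi; rewrite inE ?yl ?zl.
  - move=> y; rewrite ?inE => /orP[/eqP->|yl] hy; first by rewrite hix in hy.
    have := fx y yl hy; rewrite ?inE /= (nx y) //.
    by case/andP=> -> /= /orP[-> //|/and3P[a b d]]; rewrite a b nx // ltnS d !orbT.
  - move=> y; rewrite ?inE => H.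
    have [|z [zl hz e]] := fs y; last by exists z; rewrite ?inE zl orbT.
    by case: eqP H => //= -> /orP[->|]; rewrite ?lox ?orbT.
  - move=> y z; rewrite ?inE => /andP[yl hy] /andP[zl hz].
    by apply: fi; rewrite ?inE ?yl ?zl orbT.
  - move=> y yl hy; have := fx y; rewrite ?inE yl orbT /= (nx y) // [x == _]eq_sym.
    by move=> /(_ isT hy); case: eqP => [->|_] //=; rewrite ?lox //= ?orbF ?andbF ?orbF => /andP[->->].
  - move=> y; rewrite ?inE => H.
    have [|z [zl hz e]] := fs y.
      by rewrite ?inE; case/orP: H => [->|/andP[->->]]; rewrite ?orbT.
    exists z; split=> //; move: zl; rewrite inE => /orP[/eqP zx|//].
    by rewrite zx hix in hz.
split.
  case=> w [wA wx]; rewrite IH //; last by move=> y; rewrite ?inE => /andP[_ /Al'].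
  have wl := Al' _ wA.
  case=> f [fi fx fs]; exists (fun y => if y == x then w else f y).
  (* No later point can use [w], which is neither in [A :\ w] nor in [l]; hence the extended
     function stays injective. *)
  have fw y : y \in l -> hi y -> f y != w.
    move=> yl hy; apply/eqP=> e; have := fx y yl hy.
    by rewrite e ?inE eqxx (negbTE wl) andbF.
  split.
  - move=> y z; rewrite ?inE.
    case: (eqVneq y x) => [->|yx] /=; case: (eqVneq z x) => [->|zx] //=.
    + by move=> _ /andP[zl hz] e; have := fw z zl hz; rewrite e eqxx.
    + by move=> /andP[yl hy] _ e; have := fw y yl hy; rewrite e eqxx.
    + by move=> H1 H2; apply: fi.
  - move=> y; rewrite ?inE; case: (eqVneq y x) => [->|yx] /=; first by rewrite wA wx.
    move=> yl hy; have := fx y yl hy; rewrite ?inE /= (nx y) //.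
    case/andP=> -> /= /orP[/andP[_ ->] //|/and3P[a b d]].
    by rewrite a b nx // ltnS d !orbT.
  - move=> y; rewrite ?inE.
    have [->|yw] := eqVneq y w; first by exists x; rewrite ?inE eqxx.
    have [->|yx] := eqVneq y x; first by rewrite lox orbF => /Ax; rewrite eqxx.
    move=> /= H; have [|z [zl hz e]] := fs y; first by rewrite ?inE yw.
    exists z; rewrite ?inE zl orbT; split=> //.
    by rewrite eq_sym nx.
case=> f [fi fx fs]; exists (f x).
(* The head has index 0, so no partner can precede it in the list and [f x] must lie in [A]. *)
have := fx x; rewrite ?inE eqxx /= eqxx ltn0 !andbF orbF => /(_ isT hix) /andP[fxx fxA].
split=> //; rewrite IH // => [|y]; last by rewrite ?inE => /andP[_ /Al'].
have fw y : y \in l -> hi y -> f y != f x.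
  move=> yl hy; apply/eqP => /fi; rewrite ?inE eqxx yl hix hy orbT => /(_ isT isT) e.
  by rewrite -e yl in xl.
exists f; split.
- move=> y z; rewrite ?inE => /andP[yl hy] /andP[zl hz].
  by apply: fi; rewrite ?inE ?yl ?zl orbT.
- move=> y yl hy; have := fx y; rewrite ?inE yl orbT /= (nx y) // (fw y) // [x == _]eq_sym.
  by move=> /(_ isT hy); case: eqP => [->|_] //=; rewrite ?lox //= ?orbF ?andbF ?orbF => /andP[->->].
- move=> y; rewrite ?inE => H.
  have [|z [zl hz e]] := fs y.
    by rewrite ?inE; case/orP: H => [/andP[_ ->]|/andP[->->]]; rewrite ?orbT.
  exists z; split=> //; move: zl; rewrite inE => /orP[/eqP zx|//].
  rewrite -e zx in H.
  by move: H; rewrite eqxx (negbTE (Al' _ fxA)).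
Qed.

End Greedy.

(** * Chain partitions as pairs of perfect matchings between consecutive colours *)

Section Levels.
Variables (n : nat) (pi : {perm 'I_n}) (c : 'I_n -> 'I_3).

Let col (i : 'I_n) : nat := c (pi i).

Definition level_matching (q : nat) (f : 'I_n -> 'I_n) : Prop :=
  [/\ forall i j, col i = q.+1 -> col j = q.+1 -> f i = f j -> i = j,
      forall i, col i = q.+1 -> [/\ f i < i, pi (f i) < pi i & col (f i) = q]
    & forall j, col j = q -> exists2 i, col i = q.+1 & f i = j].

Lemma card3_ord_sorted (B : {set 'I_n}) : #|B| = 3 ->
  exists i j k : 'I_n, [/\ B = [set i; j; k], i < j & j < k].
Proof.
move=> B3; have sB : sorted (fun x y : 'I_n => x < y) (enum B).
  rewrite /enum_mem -enumT; apply: sorted_filter; first by move=> x y z; apply: ltn_trans.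
  by rewrite -(@sorted_map _ _ val ltn) val_enum_ord iota_ltn_sorted.
move: B3 sB; rewrite cardE.
case E: (enum B) => [|i [|j [|k [|? ?]]]] // _ /and3P[ij jk _].
exists i, j, k; split=> //; apply/setP=> x.
by rewrite -mem_enum E !inE orbA.
Qed.

(** Every block has exactly one point of each colour, so sending a point to the member of its block
    one colour lower gives both matchings. *)
Lemma good_partition_levels :
  has_good_triple_partition pi c ->
  (exists f, level_matching 0 f) /\ (exists g, level_matching 1 g).
Proof.
case=> P [/and3P[/eqP cP tP _] goodP].
have bP x : pblock P x \in P by rewrite pblock_mem // cP inE.
have mP x : x \in pblock P x by rewrite mem_pblock cP inE.
have blockP x : exists i j k : 'I_n, [/\ pblock P x = [set i; j; k], i < j < k,
    pi i < pi j < pi k & [/\ col i = 0, col j = 1 & col k = 2]].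
  have [/card3_ord_sorted[i [j [k [e ij jk]]]] H] := goodP _ (bP x).
  have [pij pjk ci cj ck] := H _ _ _ e ij jk.
  by exists i, j, k; rewrite ij jk pij pjk.
(* Within a block, colour, position and value increase together. *)
have mono x y z : y \in pblock P x -> z \in pblock P x -> col y < col z ->
    y < z /\ pi y < pi z.
  have [i [j [k [-> /andP[ij jk] /andP[pij pjk] [ci cj ck]]]]] := blockP x.
  rewrite !inE -!orbA => /or3P[]/eqP-> /or3P[]/eqP->; rewrite ?ci ?cj ?ck //; lia.
have same x y z : y \in pblock P x -> z \in pblock P x -> col y = col z -> y = z.
  have [i [j [k [-> _ _ [ci cj ck]]]]] := blockP x.
  by rewrite !inE -!orbA => /or3P[]/eqP-> /or3P[]/eqP->; rewrite ?ci ?cj ?ck.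
(* The member of colour [q] in the block of [x]; for [q < 3] one exists, so the default value is
   never returned. *)
pose r q x := odflt x [pick y in pblock P x | col y == q].
have rP q x : q < 3 -> r q x \in pblock P x /\ col (r q x) = q.
  move=> q3; rewrite /r; case: pickP => [y /andP[? /eqP] //|H].
  have [i [j [k [e _ _ [ci cj ck]]]]] := blockP x.
  have := H i; have := H j; have := H k; rewrite /= e !inE !eqxx !orbT /= ci cj ck.
  by case: q q3 {H} => [|[|[|]]].
have lev q : q < 2 -> level_matching q (r q).
  move=> q2; have [qq qq'] : q < 3 /\ q.+1 < 3 by lia.
  have rb x y : y \in pblock P x -> pblock P x = pblock P y by move/(same_pblock tP).
  split=> [x y cx cy e|x cx|y cy].
  - have [rx _] := rP q x qq; have [ry _] := rP q y qq.
    by apply: (same x) => //; rewrite ?cx //= (rb _ _ rx) e -(rb _ _ ry).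
  - have [rx crx] := rP q x qq.
    by have [|a b] := mono x _ _ rx (mP x); rewrite ?crx ?cx.
  - have [ry cry] := rP q.+1 y qq'; exists (r q.+1 y) => //.
    have [rry crry] := rP q (r q.+1 y) qq.
    by apply: (same y) => //; rewrite ?crry // (rb _ _ ry).
by split; [exists (r 0) | exists (r 1)]; apply: lev.
Qed.

(** The two matchings are glued along their common middle colour: each point [k] of colour 2 yields
    the block of [f (g k)], [g k] and [k]. Surjectivity makes the blocks cover everything,
    injectivity makes them disjoint. *)
Lemma levels_good_partition f g :
  level_matching 0 f -> level_matching 1 g -> has_good_triple_partition pi c.
Proof.
move=> [fi fx fs] [gi gx gs].
pose blk k := [set f (g k); g k; k].
have inv x k : col k = 2 -> x \in blk k ->
    [\/ col x = 2 /\ x = k, col x = 1 /\ x = g k | col x = 0 /\ x = f (g k)].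
  move=> ck; have [_ _ cg] := gx _ ck; have [_ _ cf] := fx _ cg.
  rewrite !inE -orbA => /or3P[]/eqP->;
    by [apply: Or33 | apply: Or32 | apply: Or31].
have disj x k k' : col k = 2 -> col k' = 2 -> x \in blk k -> x \in blk k' -> k = k'.
  move=> ck ck'; have [_ _ cg] := gx _ ck; have [_ _ cg'] := gx _ ck'.
  move=> /(inv _ _ ck)[][e xe] /(inv _ _ ck')[][]; rewrite e // => _; rewrite xe.
  - by [].
  - exact: gi.
  - by move/(fi _ _ cg cg'); apply: gi.
pose K := [set k | col k == 2].
exists [set blk k | k in K]; split.
  apply/and3P; split.
  - rewrite eqEsubset subsetT; apply/subsetP=> x _; apply/bigcupP.
    have [k ck xk] : exists2 k, col k = 2 & x \in blk k.
      case cx: (col x) => [|[|[|m]]].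
      + have [y cy <-] := fs _ cx; have [k ck <-] := gs _ cy.
        by exists k; rewrite // !inE eqxx.
      + by have [k ck <-] := gs _ cx; exists k; rewrite // !inE eqxx orbT.
      + by exists x; rewrite // !inE eqxx orbT.
      + by have := ltn_ord (c (pi x)); rewrite -/(col x) cx.
    by exists (blk k) => //; apply: imset_f; rewrite inE ck.
  - apply/trivIsetP=> _ _ /imsetP[k + ->] /imsetP[k' + ->].
    rewrite !inE => /eqP ck /eqP ck' ne; apply/pred0P=> x /=.
    apply/andP=> -[xk xk']; case/eqP: ne; congr blk; exact: (disj x).
  - apply/imsetP=> -[k _ /setP/(_ k)]; by rewrite !inE eqxx orbT.
move=> _ /imsetP[b + ->]; rewrite inE => /eqP cb.
have [gb pgb cg] := gx _ cb; have [fb pfb cf] := fx _ cg.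
split.
  rewrite /blk setUC cardsU1 cards2 !inE.
  by rewrite -!val_eqE /=; lia.
move=> i j k e ij jk.
have : i \in blk b by rewrite e !inE eqxx.
have : j \in blk b by rewrite e !inE eqxx orbT.
have : k \in blk b by rewrite e !inE eqxx orbT.
(* Of the 27 ways to identify [i], [j], [k] with members of the block, only the sorted one is
   compatible with [i < j < k]. *)
rewrite !inE -!orbA => /or3P[]/eqP ek /or3P[]/eqP ej /or3P[]/eqP ei;
  rewrite ek ej ei in ij jk *; by [lia | split].
Qed.

Definition level_greedy (q : nat) : bool :=
  greedy (fun v => c v == q :> nat) (fun v => c v == q.+1 :> nat)
    set0 [seq pi i | i <- enum 'I_n].

(** In the swept list the value [pi i] has index [i], so conjugation by [pi] turns a matching of
    values into one of positions and back. *)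
Lemma level_greedyP q : level_greedy q <-> exists f, level_matching q f.
Proof.
have ul : uniq [seq pi i | i <- enum 'I_n].
  by rewrite map_inj_uniq ?enum_uniq //; apply: perm_inj.
have ml i : pi i \in [seq pi i | i <- enum 'I_n].
  by apply: map_f; rewrite mem_enum.
have il i : index (pi i) [seq pi i | i <- enum 'I_n] = i.
  by rewrite index_map ?index_enum_ord //; apply: perm_inj.
rewrite /level_greedy greedyP // => [|y]; last by rewrite inE.
rewrite ndmatchP // => [|x /eqP->|y]; last by rewrite inE.
  split=> -[f [fi fx fs]].
    exists (fun i => (pi^-1)%g (f (pi i))); split.
    - move=> i j ci cj /perm_inj/fi; rewrite !inE !ml /= -/(col i) -/(col j) ci cj eqxx.
      by move=> /(_ isT isT) /perm_inj.
    - move=> i ci; have := fx (pi i) (ml i); rewrite -/(col i) ci => /(_ (eqxx _)).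
      rewrite inE /= => /andP[f1 /and3P[_ /eqP f2 f3]].
      by rewrite /col permKV f1 f2; split=> //; rewrite -[f _](permKV pi) !il in f3.
    - move=> j cj; have [|x [_ /eqP cx e]] := fs (pi j).
        by rewrite ml -/(col j) cj eqxx orbT.
      by exists ((pi^-1)%g x); rewrite /col permKV // e permK.
  exists (fun v => pi (f ((pi^-1)%g v))); split.
  - move=> x y; rewrite !inE => /andP[_ /eqP cx] /andP[_ /eqP cy] /perm_inj /fi.
    by rewrite /col !permKV cx cy => /(_ erefl erefl) /perm_inj.
  - move=> x _ /eqP cx; have := fx ((pi^-1)%g x); rewrite /col permKV cx => /(_ erefl).
    by case=> f1 f2 f3; rewrite f2 ml f3 eqxx il -[in index _ _](permKV pi x) il f1 orbT.
  - move=> y; rewrite inE /= => /andP[_ /eqP cy].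
    have [|i ci e] := fs ((pi^-1)%g y); first by rewrite /col permKV.
    by exists (pi i); rewrite ml -/(col i) ci eqxx permK e permKV.
by rewrite eqn_leq ltnn andbF.
Qed.

Lemma has_good_triple_partitionP :
  has_good_triple_partition pi c <-> level_greedy 0 && level_greedy 1.
Proof.
split=> [/good_partition_levels[/level_greedyP-> /level_greedyP->] //|].
by case/andP=> /level_greedyP[f fP] /level_greedyP[g]; apply: levels_good_partition fP.
Qed.

End Levels.

(** * Total correctness with time bounds *)

Definition runs (p : com) (s : state) (T : nat) (Q : state -> Prop) : Prop :=
  exists s' t, [/\ exec p s s' t, t <= T & Q s'].

Lemma runs_weaken p s T T' (Q Q' : state -> Prop) :
  runs p s T Q -> T <= T' -> (forall s', Q s' -> Q' s') -> runs p s T' Q'.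
Proof.
move=> [s' [t [e tT qs]]] TT QQ; exists s', t; split=> //; last exact: QQ.
exact: leq_trans TT.
Qed.

Lemma runs_skip s T (Q : state -> Prop) : 0 < T -> Q s -> runs CSkip s T Q.
Proof. by move=> T0 Qs; exists s, 1; split=> //; constructor. Qed.

Lemma runs_asgn s x e T (Q : state -> Prop) : 0 < T ->
  Q (State (upd (vars s) x (aeval s e)) (Defs.mem s)) -> runs (CAsgn x e) s T Q.
Proof. by move=> T0 Qs; eexists _, 1; split; [constructor| |]. Qed.

Lemma runs_store s a e T (Q : state -> Prop) : 0 < T ->
  Q (State (vars s) (upd (Defs.mem s) (aeval s a) (aeval s e))) -> runs (CStore a e) s T Q.
Proof. by move=> T0 Qs; eexists _, 1; split; [constructor| |]. Qed.

(** The judgement on the second command is the postcondition of the first, which lets a program be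
    verified by symbolic execution from front to back. *)
Lemma runs_seq p1 p2 s T1 T2 T (Q : state -> Prop) : (T1 + T2).+1 <= T ->
  runs p1 s T1 (fun s1 => runs p2 s1 T2 Q) -> runs (CSeq p1 p2) s T Q.
Proof.
move=> TT [s1 [t1 [e1 l1 [s2 [t2 [e2 l2 Qs]]]]]].
exists s2, (t1 + t2).+1; split=> //; first exact: E_Seq e1 e2.
by apply: leq_trans TT; rewrite ltnS leq_add.
Qed.

Lemma runs_if b p1 p2 s T (Q : state -> Prop) :
  (aeval s b != 0 -> runs p1 s T Q) -> (aeval s b == 0 -> runs p2 s T Q) ->
  runs (CIf b p1 p2) s T.+1 Q.
Proof.
move=> H1 H2; have [b0|b0] := boolP (aeval s b == 0).
  have [s' [t [e l Qs]]] := H2 b0; move/eqP in b0.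
  by exists s', t.+1; split=> //; apply: E_IfF.
have [s' [t [e l Qs]]] := H1 b0.
by exists s', t.+1; split=> //; apply: E_IfT.
Qed.

(** The invariant is indexed by the number of rounds done, and the loop makes exactly [m] of them.
    The proof is by induction on the rounds that remain. *)
Lemma runs_while b p s m T (I : nat -> state -> Prop) :
  (forall k s, k < m -> I k s -> aeval s b != 0 /\ runs p s T (I k.+1)) ->
  (forall s, I m s -> aeval s b = 0) ->
  I 0 s -> runs (CWhile b p) s (m * T.+1).+1 (I m).
Proof.
move=> step stop I0.
suff H d : forall k s, k + d = m -> I k s -> runs (CWhile b p) s (d * T.+1).+1 (I m).
  exact: (H m 0).
elim: d => [|d IH] k {I0}s km Is.
  rewrite addn0 in km; rewrite km in Is.
  by exists s, 1; split=> //; apply: E_WhileF; apply: stop.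
have [|b0 [s1 [t1 [e1 l1 I1]]]] := step k s _ Is; first by lia.
have [|s2 [t2 [e2 l2 I2]]] := IH k.+1 s1 _ I1; first by lia.
exists s2, (t1 + t2).+1; split=> //; first exact: E_WhileT e1 e2.
by rewrite mulSn; lia.
Qed.

(** * The decision program *)

Section Program.

(* Variables: 0 verdict, 1 the size [n], 2 the swept position, 3 the value
   searched, 4 scratch (colour, then result of the search), 5 the value at the
   swept position, 6 base address of the availability flags. *)

Definition search_com : com :=
  CWhile (ALt (AVar 3) (AVar 5))
    (CSeq (CIf (ALoad (APlus (AVar 6) (AVar 3)))
             (CAsgn 4 (APlus (AVar 3) (ANum 1))) CSkip)
          (CAsgn 3 (APlus (AVar 3) (ANum 1)))).

Definition match_com : com :=
  CSeq (CAsgn 3 (ANum 0)) (CSeq (CAsgn 4 (ANum 0)) (CSeq search_com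
    (CIf (AVar 4)
       (CStore (APlus (AVar 6) (AMinus (AVar 4) (ANum 1))) (ANum 0))
       (CAsgn 0 (ANum 0))))).

Definition sweep_com (q : nat) : com :=
  CWhile (ALt (AVar 2) (AVar 1))
    (CSeq (CAsgn 5 (ALoad (APlus (ANum 1) (AVar 2))))
    (CSeq (CAsgn 4 (ALoad (APlus (APlus (ANum 1) (AVar 1)) (AVar 5))))
    (CSeq (CIf (AEq (AVar 4) (ANum q))
             (CStore (APlus (AVar 6) (AVar 5)) (ANum 1))
             (CIf (AEq (AVar 4) (ANum q.+1)) match_com CSkip))
          (CAsgn 2 (APlus (AVar 2) (ANum 1)))))).

Definition check_com : com :=
  CWhile (ALt (AVar 2) (AVar 1))
    (CSeq (CIf (ALoad (APlus (AVar 6) (AVar 2))) (CAsgn 0 (ANum 0)) CSkip)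
          (CAsgn 2 (APlus (AVar 2) (ANum 1)))).

Definition level_com (q : nat) : com :=
  CSeq (CAsgn 2 (ANum 0)) (CSeq (sweep_com q)
    (CSeq (CAsgn 2 (ANum 0)) check_com)).

Definition decide_com : com :=
  CSeq (CAsgn 1 (ALoad (ANum 0))) (CSeq (CAsgn 0 (ANum 1))
  (CSeq (CAsgn 6 (APlus (ANum 1) (APlus (AVar 1) (AVar 1))))
  (CSeq (level_com 0)
  (CSeq (CAsgn 6 (APlus (AVar 6) (AVar 1))) (level_com 1))))).

(** * Correctness and running time of the program *)

Variables (n : nat) (pi : {perm 'I_n}) (c : 'I_n -> 'I_3).

(** The bound on [base] keeps the flags off the input cells, so that stores into the flag array
    preserve the input. *)
Definition holds_input (s : state) (base : nat) : Prop :=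
  [/\ vars s 1 = n, vars s 6 = base, n + n < base,
      forall i : 'I_n, Defs.mem s (1 + i) = pi i
    & forall v : 'I_n, Defs.mem s (1 + n + v) = c v].

(** As [v] ranges over all of [nat], this also says that every cell past the flag array is zero. *)
Definition holds_flags (s : state) (base : nat) (A : {set 'I_n}) : Prop :=
  forall v, Defs.mem s (base + v) = flag A v.

Arguments holds_input : simpl never.
Arguments holds_flags : simpl never.

(** The scan goes upwards and overwrites earlier hits, so after [k] rounds variable 4 holds
    [last_below (flag A) k]. A round costs four steps for the body and one for the loop. *)
Lemma runs_search s base A (x : 'I_n) (Q : state -> Prop) :
  holds_input s base -> holds_flags s base A ->
  vars s 5 = x -> vars s 3 = 0 -> vars s 4 = 0 ->
  (forall s', Defs.mem s' = Defs.mem s -> vars s' 4 = best A x ->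
     (forall z, z \notin [:: 3; 4] -> vars s' z = vars s z) -> Q s') ->
  runs search_com s (n * 5).+1 Q.
Proof.
move=> [v1 v6 nb mpi mc] fl v5 v3 v4 HQ.
pose I k s' := [/\ Defs.mem s' = Defs.mem s, vars s' 4 = last_below (flag A) k,
  vars s' 3 = k & forall z, z \notin [:: 3; 4] -> vars s' z = vars s z].
apply: (@runs_weaken _ _ (x * 5).+1 _ (I x)).
- apply: runs_while; last by split.
    move=> k t kx [mt t4 t3 tz] /=; rewrite t3 tz // v5 kx; split=> //.
    apply: (@runs_seq _ _ _ 2 1) => //; apply: runs_if => /=.
      rewrite mt t3 tz // v6 fl eqb0 negbK => fk.
      do 2!apply: runs_asgn => //; rewrite /upd /=; split=> //=.
      + by rewrite fk t3 addn1.
      + by rewrite t3 addn1.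
      move=> z zz; have := tz z zz; move: zz.
      by rewrite !inE negb_or => /andP[/negbTE-> /negbTE->].
    rewrite mt t3 tz // v6 fl eqb0 => /negbTE fk.
    apply: runs_skip => //; apply: runs_asgn => //; rewrite /upd /=; split=> //=.
    + by rewrite fk.
    + by rewrite t3 addn1.
    move=> z zz; have := tz z zz; move: zz.
    by rewrite !inE negb_or => /andP[/negbTE->].
  by move=> t [_ _ t3 tz] /=; rewrite t3 tz // v5 ltnn.
- by rewrite ltnS leq_mul2r ltnW.
- by move=> t [mt t4 t3 tz]; apply: HQ.
Qed.

Lemma holds_input_store s s' base v w :
  vars s' 1 = vars s 1 -> vars s' 6 = vars s 6 ->
  Defs.mem s' = upd (Defs.mem s) (base + v) w ->
  holds_input s base -> holds_input s' base.
Proof.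
move=> e1 e6 em [v1 v6 nb mpi mc]; split; rewrite ?e1 ?e6 // => i;
  rewrite em /upd ?mpi ?mc; case: eqP => // e; have := ltn_ord i; lia.
Qed.

Lemma runs_match s base A (x : 'I_n) (Q : state -> Prop) :
  holds_input s base -> holds_flags s base A -> vars s 5 = x ->
  (forall s', holds_input s' base -> vars s' 2 = vars s 2 ->
    (if best A x == 0 then vars s' 0 = 0 /\ holds_flags s' base A
     else vars s' 0 = vars s 0 /\
          holds_flags s' base [set y in A | y.+1 != best A x]) -> Q s') ->
  runs match_com s (n * 5 + 9) Q.
Proof.
move=> hin hfl v5 HQ; have [v1 v6 nb mpi mc] := hin.
apply: (@runs_seq _ _ _ 1 (n * 5 + 7)); first by lia.
apply: runs_asgn => //; apply: (@runs_seq _ _ _ 1 (n * 5 + 5)); first by lia.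
apply: runs_asgn => //; apply: (@runs_seq _ _ _ (n * 5).+1 2); first by lia.
apply: (@runs_search _ base A x) => //= s' em e4 ez.
have e0 : vars s' 0 = vars s 0 by rewrite ez.
have e1 : vars s' 1 = vars s 1 by rewrite ez.
have e2 : vars s' 2 = vars s 2 by rewrite ez.
have e6 : vars s' 6 = vars s 6 by rewrite ez.
apply: runs_if => /=; rewrite e4 => b0.
  have [y [eb yA yx _]] := best_neq0 b0.
  apply: runs_store => //=; apply: HQ => //.
    apply: (@holds_input_store s _ base y 0) => //=.
    by rewrite e4 eb e6 v6 em subSS subn0.
  rewrite (negbTE b0); split=> // v /=.
  rewrite e4 eb e6 v6 subSS subn0 /upd eqn_add2l em hfl.
  have -> : [set z in A | z.+1 != y.+1] = A :\ y.
    by apply/setP=> z; rewrite !inE eqSS andbC.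
  by rewrite flag_setD1; case: eqP.
apply: runs_asgn => //; apply: HQ => //=.
  by split; rewrite /= /upd /= ?e1 ?e6 ?em.
by rewrite b0; split=> // v; rewrite /= em.
Qed.

Lemma runs_sweep q s base :
  holds_input s base -> holds_flags s base set0 -> vars s 2 = 0 -> vars s 0 <= 1 ->
  runs (sweep_com q) s (n * (n * 5 + 20)).+1 (fun s' =>
    exists2 A : {set 'I_n}, holds_flags s' base A &
    [/\ holds_input s' base, vars s' 0 <= 1 &
        ((vars s' 0 != 0) && (A == set0)) = (vars s 0 != 0) && level_greedy pi c q]).
Proof.
move=> hin hfl v2 v0.
set vs := [seq pi i | i <- enum 'I_n].
pose lo (v : 'I_n) := c v == q :> nat; pose hi (v : 'I_n) := c v == q.+1 :> nat.
have svs : size vs = n by rewrite size_map size_enum_ord.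
(* What stays constant is the verdict so far together with the outcome of [greedy] on the unread
   values. After a failed match both sides are false, so sweeping on with any [A] is harmless. *)
pose I k s' := exists2 A : {set 'I_n}, holds_flags s' base A &
  [/\ holds_input s' base, vars s' 2 = k, vars s' 0 <= 1 &
    ((vars s' 0 != 0) && greedy lo hi A (drop k vs))
      = (vars s 0 != 0) && level_greedy pi c q].
apply: (@runs_weaken _ _ (n * (n * 5 + 20)).+1 _ (I n)) => //; last first.
  move=> t [A fA [it _ t0 e]]; exists A => //; split=> //.
  by rewrite -e drop_oversize ?svs.
rewrite addnS; apply: runs_while; last by exists set0 => //; rewrite drop0.
  move=> k t kn [A fA [it t2 t0 e]] /=.
  have [t1 t6 nb mpi mc] := it; rewrite t1 t2 kn; split=> //.
  pose i := Ordinal kn; pose x := pi i.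
  have dk : drop k vs = x :: drop k.+1 vs.
    rewrite (drop_nth x) ?svs // (nth_map i) ?size_enum_ord //.
    by rewrite (nth_ord_enum i i).
  apply: (@runs_seq _ _ _ 1 (n * 5 + 17)); first by lia.
  apply: runs_asgn => //=; rewrite t2 (mpi i) -/x.
  apply: (@runs_seq _ _ _ 1 (n * 5 + 15)); first by lia.
  apply: runs_asgn => //=; rewrite /upd /= t1 (mc x).
  apply: (@runs_seq _ _ _ (n * 5 + 9).+2 1); first by lia.
  rewrite dk /= in e.
  apply: runs_if => /=; rewrite eqb0 ?negbK => cx; rewrite /lo ?cx ?(negbTE cx) -/lo in e.
    apply: runs_store; rewrite ?addnS //=; apply: runs_asgn => //=; rewrite /upd /=.
    exists (x |: A).
      move=> v /=; rewrite t6 eqn_add2l flag_setU1 fA; by case: eqP.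
    split=> //=; rewrite ?t2 ?addn1 //.
    by apply: (@holds_input_store t _ base x 1) => //=; rewrite t6.
  apply: runs_if => /=; rewrite eqb0 ?negbK => hx; rewrite /hi ?hx ?(negbTE hx) -/hi in e.
    apply: (@runs_match _ base A x) => //= s' is' s2 H.
    apply: runs_asgn => //=; rewrite /upd /=.
    rewrite s2 /= ?t2 addn1.
    move: H; case: (best A x =P 0) e => /= [_ e [s0 fs]|_ e [s0 fs]].
      by exists A => //; split=> //=; rewrite s0 //= -e andbF.
    exists [set y in A | y.+1 != best A x] => //.
    by split=> //=; rewrite s0.
  apply: runs_skip; rewrite ?addnS //; apply: runs_asgn => //=; rewrite /upd /=.
  by exists A => //; split=> //=; rewrite ?t2 addn1.
by move=> t [A fA [[t1 _ _ _ _] t2 _ _]] /=; rewrite t1 t2 ltnn.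
Qed.

Lemma runs_check s base A :
  holds_input s base -> holds_flags s base A -> vars s 2 = 0 -> vars s 0 <= 1 ->
  runs check_com s (n * 5).+1 (fun s' =>
    [/\ holds_input s' base, forall v, n <= v -> Defs.mem s' (base + v) = 0 &
        vars s' 0 = (vars s 0 != 0) && (A == set0)]).
Proof.
move=> hin hfl v2 v0.
(* At [k = n] the last clause says that [A] is empty, since all its elements are below [n]. *)
pose I k s' := [/\ holds_input s' base, Defs.mem s' = Defs.mem s, vars s' 2 = k &
  vars s' 0 = (vars s 0 != 0) && [forall y in A, k <= y]].
apply: (@runs_weaken _ _ (n * 5).+1 _ (I n)) => //; last first.
  move=> t [it mt _ t0]; split=> // [v nv|]; first by rewrite mt hfl flag_ge.
  rewrite t0; congr (nat_of_bool (_ && _)); apply/forall_inP/eqP => [H|-> y].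
    by apply/setP=> y; rewrite inE; apply/negP=> /H; rewrite leqNgt ltn_ord.
  by rewrite inE.
apply: runs_while.
- move=> k t kn [it mt t2 t0] /=; have [t1 t6 nb mpi mc] := it.
  rewrite t1 t2 kn; split=> //.
  have fS : [forall y in A, k < y] = ~~ flag A k && [forall y in A, k <= y].
    rewrite (flag_ord A (Ordinal kn)); apply/forall_inP/andP => [H|[kA /forall_inP H] y yA].
      by split; [apply/negP=> /H; rewrite ltnn | apply/forall_inP=> y /H/ltnW].
    rewrite ltn_neqAle H // andbT; apply: contraNneq kA => ky.
    by rewrite (_ : Ordinal kn = y) //; apply: val_inj.
  apply: (@runs_seq _ _ _ 2 1) => //.
  apply: runs_if => /=; rewrite t6 t2 mt hfl eqb0 => fk.
    move/negPn in fk; apply: runs_asgn => //; apply: runs_asgn => //; rewrite /upd /=.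
    by split; rewrite //= ?t2 ?addn1 // fS fk andbF.
  apply: runs_skip => //; apply: runs_asgn => //; rewrite /upd /=.
  by split; rewrite //= ?t2 ?addn1 // fS (negbTE fk).
- by move=> t [[t1 _ _ _ _] _ t2 _] /=; rewrite t1 t2 ltnn.
- split=> //; suff -> : [forall y in A, 0 <= y] by case: (vars s 0) v0 => [|[]].
  exact/forall_inP.
Qed.

Lemma runs_level q s base :
  holds_input s base -> holds_flags s base set0 -> vars s 0 <= 1 ->
  runs (level_com q) s (n * (n * 5 + 25) + 7) (fun s' =>
    [/\ holds_input s' base, forall v, n <= v -> Defs.mem s' (base + v) = 0 &
        vars s' 0 = (vars s 0 != 0) && level_greedy pi c q]).
Proof.
move=> hin hfl v0.
apply: (@runs_seq _ _ _ 1 (n * (n * 5 + 25) + 5)); first by lia.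
apply: runs_asgn => //.
apply: (@runs_seq _ _ _ (n * (n * 5 + 20)).+1 (n * 5 + 3)); first by lia.
apply: runs_weaken (@runs_sweep q _ base _ _ _ _) _ _ => //= s' [A fA [is' s0 e]].
apply: (@runs_seq _ _ _ 1 (n * 5 + 1)); first by lia.
apply: runs_asgn => //; rewrite addn1.
by apply: runs_weaken (@runs_check _ base A _ _ _ _) _ _ => //= s2 [? ? ->]; rewrite -e.
Qed.

Lemma init_state_input (i : 'I_n) :
  Defs.mem (init_state pi c) (1 + i) = pi i /\
  Defs.mem (init_state pi c) (1 + n + i) = c i.
Proof.
rewrite /= !add0n; split.
  by rewrite (insubT (fun x => x < n) (ltn_ord i)) /=; congr (val (pi _)); apply: val_inj.
rewrite insubF ?addKn; last by rewrite ltnNge leq_addr.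
by rewrite (insubT (fun x => x < n) (ltn_ord i)) /=; congr (val (c _)); apply: val_inj.
Qed.

Lemma init_state_beyond v : Defs.mem (init_state pi c) (1 + (n + n) + v) = 0.
Proof.
rewrite /= insubF; last by lia.
by rewrite insubF //; lia.
Qed.

Lemma runs_decide :
  runs decide_com (init_state pi c) (2 * (n * (n * 5 + 25)) + 30)
    (fun s' => vars s' 0 = level_greedy pi c 0 && level_greedy pi c 1).
Proof.
set w := n * (n * 5 + 25).
apply: (@runs_seq _ _ _ 1 (2 * w + 28)); first by lia.
apply: runs_asgn => //; apply: (@runs_seq _ _ _ 1 (2 * w + 26)); first by lia.
apply: runs_asgn => //; apply: (@runs_seq _ _ _ 1 (2 * w + 24)); first by lia.
apply: runs_asgn => //; apply: (@runs_seq _ _ _ (w + 7) (w + 16)); first by lia.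
set s0 := State _ _.
have i0 : holds_input s0 (1 + (n + n)).
  by split=> //= i; have [] := init_state_input i.
have f0 : holds_flags s0 (1 + (n + n)) set0.
  by move=> v; rewrite flag_set0; apply: init_state_beyond.
apply: runs_weaken (@runs_level 0 s0 _ i0 f0 _) _ _ => //= s1 [[v1 v6 nb mpi mc] z e].
apply: (@runs_seq _ _ _ 1 (w + 14)); first by lia.
apply: runs_asgn => //=; set s2 := State _ _.
have i2 : holds_input s2 (1 + (n + n) + n).
  by split=> //=; rewrite /upd /= ?v6 ?v1 //; lia.
(* The second array lies beyond the first, where the first level guarantees zero cells. *)
have f2 : holds_flags s2 (1 + (n + n) + n) set0.
  by move=> v; rewrite flag_set0 /= -addnA z // leq_addr.
apply: runs_weaken (@runs_level 1 s2 _ i2 f2 _) _ _; rewrite /= /upd /= ?e ?leq_b1 //.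
  by rewrite leq_add2l.
by move=> s' [_ _ ->]; rewrite eqb0 negbK.
Qed.

End Program.

Theorem mainTheorem7 :
  exists (prog : com) (k : nat),
    forall (n : nat) (pi : {perm 'I_n}) (c : 'I_n -> 'I_3),
      exists (s' : state) (t : nat),
        [/\ exec prog (init_state pi c) s' t,
            (t <= k * (n.+1) ^ k)%N
          & (output s' <-> has_good_triple_partition pi c)].
Proof.
(* The running time is at most [10 n^2 + 50 n + 30], hence at most [80 (n+1)^2]. As [k] is both
   factor and exponent, the square is then bounded by the 80th power. *)
exists decide_com, 80 => n pi c.
have [s' [t [e tT s0]]] := runs_decide pi c; exists s', t; split=> //.
  have : n.+1 ^ 2 <= n.+1 ^ 80 by rewrite leq_pexp2l.
  by move: (n.+1 ^ 80) => N; rewrite expnS expn1 => H; nia.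
by rewrite has_good_triple_partitionP /output s0 eqb0 negbK.
Qed.
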